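(* Let $X_1,\ldots,X_n\in\mathbb R^p$ ($n\ge1$) be given data, $\bar X=\frac1n\sum_i X_i$ and $S=\frac1n\sum_i(X_i-\bar X)(X_i-\bar X)^\top$. Let $\Psi\in\mathcal P_p$, $m\ge p$, $q\in\{1,2,\ldots\}$, and consider the (unnormalized) posterior $$\pi(\mu,\Sigma)=L(\mu,\Sigma)\cdot\mathcal W^{-q}(\Sigma\mid\Psi,m),\qquad \mu\in\mathbb R^p,\ \Sigma\in\mathcal P_p,$$ where $L(\mu,\Sigma)=|\Sigma|^{-n/2}\exp\big(-\tfrac12\sum_{i=1}^n(X_i-\mu)^\top\Sigma^{-1}(X_i-\mu)\big)$. Let $A=\Psi^{-1/2}S\Psi^{-1/2}$, write $A=V\operatorname{diag}(a_1,\ldots,a_p)V^\top$ with $V$ orthogonal, and let $N=n+p+qm+1$. Then: (i) for each $i$, the equation $q\lambda^q+n a_i\lambda-N=0$ has exactly one positive solution $\hat\lambda_i$; (ii) $\pi$ has a unique maximizer $(\hat\mu,\hat\Sigma)$ over $\mathbb R^p\times\mathcal P_p$, given by $\hat\mu=\bar X$ and $$\hat\Sigma=\Psi^{1/2}V\hat\Delta^{-1}V^\top\Psi^{1/2},\qquad \hat\Delta=\operatorname{diag}(\hat\lambda_1,\ldots,\hat\lambda_p).$$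
   Context: $\mathcal P_p$ is the set of positive definite $p\times p$ real matrices; $\Psi^{1/2}$ is the positive definite square root and $\Psi^{-1/2}=(\Psi^{1/2})^{-1}$. The power inverse Wishart density is $\mathcal W^{-q}(\Sigma\mid\Psi,m)=c_{m,q}^{-1}\exp(-\tfrac12\operatorname{tr}((\Psi^{-1/2}\Sigma\Psi^{-1/2})^{-q}))|\Psi|^{qm/2}|\Sigma|^{-(qm+p+1)/2}$ with $c_{m,q}\in(0,\infty)$ a normalizing constant. The maximizer of $\pi$ is called the (power inverse Wishart) MAP estimator; it corresponds to a power inverse Wishart prior on $\Sigma$ and an improper uniform prior on $\mu$. *)

(* Defs.v *)
(* MathComp matrices over Stdlib's real numbers R.
   We equip Stdlib's R with MathComp eqType/choiceType/field structures
   (as mathcomp-analysis' Rstruct does), so that matrices, det, trace,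
   invmx, diag_mx are MathComp's, while exp / Rpower / order are Stdlib's. *)
From HB Require Import structures.
From Stdlib Require Import Reals Lra ClassicalEpsilon FunctionalExtensionality.
From mathcomp Require Import all_boot all_algebra.
Set Implicit Arguments. Unset Strict Implicit. Unset Printing Implicit Defensive.

Definition Req_bool (x y : R) : bool := if Req_EM_T x y then true else false.
Lemma Req_boolP : Equality.axiom Req_bool.
Proof. move=> x y; rewrite /Req_bool; case: Req_EM_T => h; by constructor. Qed.
HB.instance Definition _ := hasDecEq.Build R Req_boolP.

Definition R_find (P : pred R) (n : nat) : option R :=
  match excluded_middle_informative (exists x, P x) with
  | left h => Some (proj1_sig (constructive_indefinite_description _ h))
  | right _ => None
  end.
Lemma R_find_correct P n x : R_find P n = Some x -> P x.
Proof.
rewrite /R_find; case: excluded_middle_informative => // h [<-].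
exact: proj2_sig (constructive_indefinite_description _ h).
Qed.
Lemma R_find_complete (P : pred R) : (exists x, P x) -> exists n, R_find P n.
Proof. move=> h; exists 0%N; rewrite /R_find; by case: excluded_middle_informative. Qed.
Lemma R_find_ext (P Q : pred R) : P =1 Q -> R_find P =1 R_find Q.
Proof. by move=> /functional_extensionality ->. Qed.
HB.instance Definition _ := hasChoice.Build R R_find_correct R_find_complete R_find_ext.

Lemma R_addA : forall x y z : R, Rplus x (Rplus y z) = Rplus (Rplus x y) z. Proof. move=> x y z; lra. Qed.
Lemma R_addC : forall x y : R, Rplus x y = Rplus y x. Proof. move=> x y; lra. Qed.
Lemma R_add0 : forall x : R, Rplus (IZR Z0) x = x. Proof. move=> x; lra. Qed.
Lemma R_addN : forall x : R, Rplus (Ropp x) x = (IZR Z0). Proof. move=> x; lra. Qed.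
HB.instance Definition _ := GRing.isZmodule.Build R R_addA R_addC R_add0 R_addN.

Lemma R_mulA : forall x y z : R, Rmult x (Rmult y z) = Rmult (Rmult x y) z. Proof. move=> x y z; ring. Qed.
Lemma R_mulC : forall x y : R, Rmult x y = Rmult y x. Proof. move=> x y; ring. Qed.
Lemma R_mul1 : forall x : R, Rmult (IZR (Zpos xH)) x = x. Proof. move=> x; ring. Qed.
Lemma R_mulDl : forall x y z : R, Rmult (Rplus x y) z = Rplus (Rmult x z) (Rmult y z). Proof. move=> x y z; ring. Qed.
Lemma R_one_neq0 : ((IZR (Zpos xH)) : R) != (IZR Z0).
Proof. apply/eqP; exact: R1_neq_R0. Qed.
HB.instance Definition _ :=
  GRing.Zmodule_isComNzRing.Build R R_mulA R_mulC R_mul1 R_mulDl R_one_neq0.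

Definition R_inv (x : R) : R := Rinv x.
Lemma R_mulVf (x : R) : x != (IZR Z0) -> Rmult (R_inv x) x = (IZR (Zpos xH)).
Proof. move=> /eqP h; exact: Rinv_l. Qed.
Lemma R_inv0 : R_inv (IZR Z0) = (IZR Z0).
Proof. exact: Rinv_0. Qed.
HB.instance Definition _ := GRing.ComNzRing_isField.Build R R_mulVf R_inv0.

Local Open Scope ring_scope.

Definition posdef (p : nat) (M : 'M[R]_p) : Prop :=
  M^T = M /\ forall x : 'cV[R]_p, x != 0 -> Rlt (IZR Z0) ((x^T *m M *m x) ord0 ord0).

Definition xbar (p n : nat) (X : 'I_n -> 'cV[R]_p) : 'cV[R]_p :=
  (Rinv (INR n)) *: \sum_(i < n) X i.

Definition scov (p n : nat) (X : 'I_n -> 'cV[R]_p) : 'M[R]_p :=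
  (Rinv (INR n)) *: \sum_(i < n) ((X i - xbar X) *m (X i - xbar X)^T).

Definition lik (p n : nat) (X : 'I_n -> 'cV[R]_p) (mu : 'cV[R]_p) (Sig : 'M[R]_p) : R :=
  Rmult (Rpower (\det Sig) (Ropp (Rdiv (INR n) (IZR (Zpos 2%positive)))))
        (exp (Rmult (Ropp (Rinv (IZR (Zpos 2%positive))))
                    (\sum_(i < n) ((X i - mu)^T *m invmx Sig *m (X i - mu)) ord0 ord0))).

(* Power inverse Wishart density W^{-q}(Sigma | Psi, m), where Psih is the positive
   definite square root Psi^{1/2} of Psi and c is the normalising constant c_{m,q}:
   c^{-1} exp(-1/2 tr((Psi^{-1/2} Sigma Psi^{-1/2})^{-q})) |Psi|^{qm/2} |Sigma|^{-(qm+p+1)/2} *)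
Definition piw_density (p : nat) (c : R) (Psi Psih : 'M[R]_p) (m : R) (q : nat)
    (Sig : 'M[R]_p) : R :=
  let W := invmx Psih *m Sig *m invmx Psih in
  Rmult (Rmult (Rmult (Rinv c)
    (exp (Rmult (Ropp (Rinv (IZR (Zpos 2%positive)))) (\tr ((invmx W) ^+ q)))))
    (Rpower (\det Psi) (Rdiv (Rmult (INR q) m) (IZR (Zpos 2%positive)))))
    (Rpower (\det Sig)
       (Ropp (Rdiv (Rplus (Rplus (Rmult (INR q) m) (INR p)) (IZR (Zpos xH)))
                   (IZR (Zpos 2%positive))))).

Definition posterior (p n : nat) (X : 'I_n -> 'cV[R]_p) (c : R) (Psi Psih : 'M[R]_p)
    (m : R) (q : nat) (mu : 'cV[R]_p) (Sig : 'M[R]_p) : R :=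
  Rmult (lik X mu Sig) (piw_density c Psi Psih m q Sig).

(* Main.v *)
Require Import Defs.
From HB Require Import structures.
From Stdlib Require Import Reals.
From mathcomp Require Import all_boot all_order all_algebra ring.
Set Implicit Arguments. Unset Strict Implicit. Unset Printing Implicit Defensive.
(* In the coordinates B = V^T Psi^{1/2} Sigma^{-1} Psi^{1/2} V, twice the log
   posterior is, up to a constant,
     N ln det B - tr B^q - n sum_i a_i B_ii - n (xbar - mu)^T Sigma^{-1} (xbar - mu).
   Hadamard's inequality det B <= prod_i B_ii (equality only for diagonal B) and
   tr B^q >= sum_i B_ii^q bound it by the sum over i of
   N ln b - b^q - n a_i b at b = B_ii, and each summand has its strict maximum at
   the root of q b^q + n a_i b = N. *)

Import Order.TTheory GRing.Theory Num.Theory.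
Local Open Scope ring_scope.

(** * Positive definite matrices over a real field, up to Hadamard's inequality *)

Section PositiveDefinite.
Variable F : realFieldType.

Definition bform {p} (M : 'M[F]_p) (x y : 'cV[F]_p) : F := (x^T *m M *m y) 0 0.

(** [posdef] restated with MathComp's order, over any real field; [posdefP] links the two. *)
Definition pdmx {p} (M : 'M[F]_p) : Prop :=
  M^T = M /\ forall x : 'cV[F]_p, x != 0 -> 0 < bform M x x.

Lemma bform_sub {p} (M : 'M[F]_p) x y t : M^T = M ->
  bform M (y - t *: x) (y - t *: x) =
  bform M y y - 2 * t * bform M x y + t ^+ 2 * bform M x x.
Proof.
move=> sM; have sym : bform M y x = bform M x y.
  have -> : bform M x y = (x^T *m M *m y)^T 0 0 by rewrite [RHS]mxE.
  by rewrite !trmx_mul trmxK sM mulmxA.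
suff -> : bform M (y - t *: x) (y - t *: x) =
  bform M y y - t * bform M y x - t * bform M x y + t * t * bform M x x.
  by rewrite sym; ring.
rewrite /bform [(y - _)^T]linearB /= [(t *: x)^T]linearZ /= !mulmxBl !mulmxBr.
rewrite -!scalemxAl -!scalemxAr !mxE.
by ring.
Qed.

Lemma bform_congr {p} (M P : 'M[F]_p) x y :
  bform (P^T *m M *m P) x y = bform M (P *m x) (P *m y).
Proof. by rewrite /bform trmx_mul !mulmxA. Qed.

Lemma bform_delta {p} (M : 'M[F]_p) i :
  bform M (delta_mx i 0) (delta_mx i 0) = M i i.
Proof. by rewrite /bform trmx_delta -rowE -colE !mxE. Qed.

Section Theory.
Variable p : nat.
Implicit Types (M P : 'M[F]_p) (x y : 'cV[F]_p).

Lemma pdmx_ge0 M x : pdmx M -> 0 <= bform M x x.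
Proof.
move=> [_ pM]; have [->|/pM/ltW //] := eqVneq x 0.
by rewrite /bform mulmx0 mxE.
Qed.

Lemma pdmx_diag_gt0 M i : pdmx M -> 0 < M i i.
Proof.
move=> [_ pM]; rewrite -bform_delta; apply: pM; apply/eqP => /matrixP/(_ i 0).
by rewrite !mxE !eqxx /= => /eqP; rewrite oner_eq0.
Qed.

Lemma pdmx_unit M : pdmx M -> M \in unitmx.
Proof.
move=> [sM pM]; rewrite -row_free_unit; apply: inj_row_free => v vM.
apply/eqP/negPn/negP; rewrite -trmx_eq0 => /pM.
by rewrite /bform trmxK vM mul0mx mxE ltxx.
Qed.

Lemma pdmx_congr M P : P \in unitmx -> pdmx M -> pdmx (P^T *m M *m P).
Proof.
move=> uP [sM pM]; split=> [|x x0]; first by rewrite !trmx_mul trmxK sM mulmxA.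
rewrite bform_congr; apply: pM; apply: contraNneq x0 => Px.
by rewrite -(mulKmx uP x) Px mulmx0.
Qed.

(** For symmetric [M], the inverse is itself a congruence of [M], by [invmx M]. *)
Lemma pdmx_inv M : pdmx M -> pdmx (invmx M).
Proof.
move=> pM; have uM := pdmx_unit pM; have sM := pM.1.
have -> : invmx M = (invmx M)^T *m M *m invmx M.
  by rewrite trmx_inv sM mulVmx // mul1mx.
by apply: pdmx_congr; rewrite ?unitmx_inv.
Qed.

Lemma pdmx_diag (d : 'rV[F]_p) : (forall i, 0 < d 0 i) -> pdmx (diag_mx d).
Proof.
move=> d_gt0; split=> [|x x0]; first by rewrite tr_diag_mx.
have -> : bform (diag_mx d) x x = \sum_i d 0 i * x i 0 ^+ 2.
  rewrite /bform mul_mx_diag mxE; apply: eq_bigr => i _; rewrite !mxE; ring.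
have [i xi] : exists i, x i 0 != 0.
  apply/existsP; apply: contraR x0; rewrite negb_exists => /forallP x0.
  by apply/eqP/colP => i; rewrite mxE; apply/eqP; rewrite -[_ == _]negbK x0.
rewrite (bigD1 i) //= ltr_wpDr ?sumr_ge0 // => [j _|].
  by rewrite mulr_ge0 ?sqr_ge0 // ltW.
by rewrite mulr_gt0 // lt_def sqr_ge0 sqrf_eq0 xi.
Qed.

(** [M ^+ k.+2] is the congruence [M^T *m M ^+ k *m M], so the induction goes in steps of two, from
    [M ^+ 0] and [M ^+ 1]. *)
Lemma pdmx_exp M k : pdmx M -> pdmx (M ^+ k).
Proof.
move=> pM; suff : pdmx (M ^+ k) /\ pdmx (M ^+ k.+1) by case.
elim: k => [|k [IH IH1]]; split=> //.
  rewrite expr0 -[1]/(1%:M : 'M_p) -diag_const_mx; apply: pdmx_diag => i.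
  by rewrite mxE.
rewrite exprS exprSr -!mulmxE mulmxA -[X in X *m _ *m _]pM.1.
by apply: pdmx_congr => //; exact: pdmx_unit.
Qed.

Lemma pdmx_CauchySchwarz M x y : pdmx M ->
  bform M x y ^+ 2 <= bform M x x * bform M y y.
Proof.
move=> pM; have [->|x0] := eqVneq x 0.
  by rewrite /bform trmx0 !mul0mx mxE expr2 !mul0r.
have a0 := pM.2 _ x0; set a := bform M x x in a0 *.
(* The coefficient [bform M x y / a] minimizes the form of [y - t *: x] over [t]. *)
have := pdmx_ge0 (y - (bform M x y / a) *: x) pM; rewrite bform_sub ?pM.1 // -/a.
set b := bform M x y; set d := bform M y y.
have -> : d - 2 * (b / a) * b + (b / a) ^+ 2 * a = (a * d - b ^+ 2) / a.
  by field; rewrite gt_eqF.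
by rewrite pmulr_lge0 ?invr_gt0 // subr_ge0.
Qed.

(* By Cauchy-Schwarz for the form of [M ^+ k], the diagonal entry of [M ^+ k]
   is log-convex in [k], and it is 1 for [k = 0]. *)
Lemma pdmx_exp_diag M k i : pdmx M -> M i i ^+ k <= (M ^+ k) i i.
Proof.
move=> pM; pose e : 'cV[F]_p := delta_mx i 0.
have f_gt0 j : 0 < (M ^+ j) i i by apply/pdmx_diag_gt0/pdmx_exp.
have step j : M i i * (M ^+ j) i i <= (M ^+ j.+1) i i.
  elim: j => [|j IH]; first by rewrite expr0 expr1 !mxE eqxx mulr1.
  have := pdmx_CauchySchwarz e (M *m e) (pdmx_exp j pM).
  have -> : bform (M ^+ j) e (M *m e) = (M ^+ j.+1) i i.
    by rewrite -bform_delta exprSr -mulmxE /bform !mulmxA.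
  have -> : bform (M ^+ j) (M *m e) (M *m e) = (M ^+ j.+2) i i.
    by rewrite -bform_congr pM.1 bform_delta exprSr exprS.
  rewrite bform_delta => CS; rewrite -(ler_pM2l (f_gt0 j)); apply: le_trans CS.
  by rewrite mulrCA mulrA expr2 ler_pM2r.
elim: k => [|k IH]; first by rewrite !expr0 mxE eqxx.
rewrite exprS; apply: le_trans (step k).
by rewrite ler_pM2l // pdmx_diag_gt0.
Qed.

End Theory.

(* Induction on the size: the determinant is [det C] times the Schur complement
   [b - u^T C^-1 u] of the lower right block [C], which is at most the corner
   entry [b], with equality only when the off-diagonal block [u] vanishes. *)
Lemma pdmx_Hadamard {p} (M : 'M[F]_p) : pdmx M ->
  0 < \det M /\ \det M <= \prod_i M i i ?= iff is_diag_mx M.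
Proof.
elim: p M => [|p IH] M pM.
  rewrite det_mx00 big_ord0 ltr01; split=> //.
  have -> : is_diag_mx M by apply/is_diag_mxP => -[].
  exact: leif_refl.
rewrite -[p.+1]/(1 + p)%N in M pM *.
have [sM pos] := pM; rewrite -[M]submxK tr_block_mx in sM.
have [_ sU _ sC] := eq_block_mx sM.
set u := dlsubmx M in sU sC; set C := drsubmx M in sU sC.
have eM : M = block_mx (ulsubmx M) u^T u C by rewrite sU submxK.
have xN0 (x : 'cV[F]_p) : x != 0 -> col_mx 0 x != 0 :> 'cV_(1 + p).
  by apply: contraNneq => /(congr1 dsubmx); rewrite col_mxKd linear0 => ->.
have pC : pdmx C.
  split=> // x /xN0/pos; rewrite /bform [in X in X -> _]eM tr_col_mx.
  by rewrite mul_row_block mul_row_col trmx0 !mul0mx mulmx0 !add0r.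
have uC := pdmx_unit pC; have pCi := pdmx_inv pC.
have [dC HC] := IH C pC.
set b := M 0 0; set s := bform (invmx C) u u.
have eb : ulsubmx M = b%:M.
  by rewrite [LHS]mx11_scalar !mxE; congr (M _ _)%:M; apply/val_inj.
have s1 : u^T *m invmx C *m u = s%:M by rewrite [LHS]mx11_scalar.
have dM : \det M = (b - s) * \det C.
  (* This unipotent factor clears the upper right block of [M] and leaves [b - s] in the corner. *)
  have := det_mulmx (block_mx 1%:M (- (u^T *m invmx C)) 0 1%:M) M.
  rewrite [in X in \det X = _]eM mulmx_block det_ublock !det1 mulr1 mul1r.
  rewrite !mul1mx !mulNmx mulmxKV // subrr !mul0mx !add0r det_lblock => <-.
  by rewrite s1 eb -[_ - _]raddfB det_scalar1.
have bs : 0 < b - s.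
  (* Among vectors with first entry 1, this one minimizes the form of [M]; the minimum is the Schur
     complement. *)
  pose x : 'cV_(1 + p) := col_mx 1%:M (- (invmx C *m u)).
  have := pos x; have -> : bform M x x = b - s.
    rewrite /x /bform [in LHS]eM tr_col_mx mul_row_block mul_row_col.
    rewrite trmx1 !mul1mx linearN /= trmx_mul trmx_inv sC mulmx1 !mulNmx.
    by rewrite mulmxKV // subrr mul0mx addr0 s1 eb !mxE !eqxx.
  apply; apply/eqP => /(congr1 usubmx)/matrixP/(_ 0 0).
  by rewrite col_mxKu linear0 !mxE eqxx => /eqP; rewrite oner_eq0.
split; first by rewrite dM mulr_gt0.
have s0 : 0 <= s by apply: pdmx_ge0.
have sE : (s == 0) = (u == 0).
  apply/eqP/eqP => [s00|u0]; last by rewrite /s u0 /bform mulmx0 mxE.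
  by apply/eqP/negPn/negP => /pCi.2; rewrite -/s s00 ltxx.
have leb : b - s <= b ?= iff (u == 0).
  by apply/leifP; rewrite -sE; case: eqVneq => [->|sN]; rewrite ?subr0 //
    gtrBl lt_def sN s0.
have -> : is_diag_mx M = (u == 0) && is_diag_mx C.
  rewrite [in LHS]eM is_diag_block_mx // trmx_eq0 mx11_is_diag.
  by case: (u == 0).
have eP : \prod_i M i i = b * \prod_i C i i.
  rewrite big_ord_recl; congr (_ * _); apply: eq_bigr => i _.
  by rewrite !mxE; congr (M _ _); apply/val_inj.
have dI : 0 < \prod_i C i i by rewrite prodr_gt0 // => i _; exact: pdmx_diag_gt0.
(* [leif_pM] also allows equality when the larger product is zero; positivity of [b] and of the
   diagonal of [C] excludes that. *)
rewrite eP dM; have := leif_pM (ltW bs) (ltW dC) leb HC.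
rewrite [_ * _ == 0](gt_eqF _) //=.
by rewrite mulr_gt0 // (lt_le_trans bs) // leb.1.
Qed.

End PositiveDefinite.

(** * The order of Stdlib's reals as a MathComp order, and logarithm inequalities *)

Definition Rleb (x y : R) : bool := if Rle_dec x y then true else false.

Lemma RlebP x y : reflect (Rle x y) (Rleb x y).
Proof. by rewrite /Rleb; case: Rle_dec => ?; constructor. Qed.

Lemma Rleb0_add (x y : R) : Rleb 0 x -> Rleb 0 y -> Rleb 0 (x + y).
Proof. by move=> /RlebP ? /RlebP ?; apply/RlebP; exact: Rplus_le_le_0_compat. Qed.
Lemma Rleb0_mul (x y : R) : Rleb 0 x -> Rleb 0 y -> Rleb 0 (x * y).
Proof. by move=> /RlebP ? /RlebP ?; apply/RlebP; exact: Rmult_le_pos. Qed.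
Lemma Rleb0_anti (x : R) : Rleb 0 x -> Rleb x 0 -> x = 0.
Proof. by move=> /RlebP ? /RlebP ?; exact: Rle_antisym. Qed.
Lemma Rleb_sub_ge0 (x y : R) : Rleb 0 (y - x) = Rleb x y.
Proof.
apply/RlebP/RlebP => [/(Rplus_le_compat_r x)|/(Rplus_le_compat_r (- x))].
  by rewrite -[Rplus 0 x]/(0 + x) -[Rplus _ x]/(y - x + x) add0r subrK.
by rewrite -[Rplus x _]/(x - x) subrr.
Qed.
Lemma Rleb0_total (x : R) : Rleb 0 x || Rleb x 0.
Proof.
by case: (Rle_or_lt 0 x) => [/RlebP ->|/Rlt_le/RlebP ->]; rewrite ?orbT.
Qed.
Lemma Rabs_normN (x : R) : Rabs (- x) = Rabs x. Proof. exact: Rabs_Ropp. Qed.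
Lemma Rleb0_norm (x : R) : Rleb 0 x -> Rabs x = x.
Proof. by move=> /RlebP/Rle_ge; exact: Rabs_right. Qed.

HB.instance Definition _ := Num.IntegralDomain_isLeReal.Build R
  Rleb0_add Rleb0_mul Rleb0_anti Rleb_sub_ge0 Rleb0_total Rabs_normN Rleb0_norm
  (fun _ _ => erefl).

Lemma RleP (x y : R) : reflect (Rle x y) (x <= y).
Proof. exact: RlebP. Qed.

Lemma RltP (x y : R) : reflect (Rlt x y) (x < y).
Proof.
apply: (iffP idP) => [/andP[/eqP yx /RlebP [//|xy]]|xy]; first by case: yx.
by apply/andP; split; [apply/eqP => /esym; exact: Rlt_not_eq|apply/RlebP/Rlt_le].
Qed.

Lemma INRE k : INR k = k%:R.
Proof. by elim: k => // k IH; rewrite S_INR IH mulrSr. Qed.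

Lemma powE x k : pow x k = x ^+ k.
Proof. by elim: k => // k IH; rewrite exprS -IH. Qed.

Lemma posdefP p (M : 'M[R]_p) : posdef M <-> pdmx M.
Proof. by split=> -[sM pM]; split=> // x /pM/RltP. Qed.

(** The strict case is [1 + y < exp y] for nonzero [y], taken at [y = ln x]. *)
Lemma ln_le_sub1 (x : R) : 0 < x -> ln x <= x - 1 ?= iff (x == 1).
Proof.
move=> x0; apply/leifP; case: eqVneq => [->|x1].
  by rewrite subrr; apply/eqP; exact: ln_1.
have lx : ln x <> 0.
  move=> l0; move/eqP: x1; apply; apply: ln_inv; first exact/RltP.
    exact: Rlt_0_1.
  by rewrite ln_1.
have /RltP := exp_ineq1 _ lx; rewrite exp_ln; last exact/RltP.
by rewrite ltrBrDl.
Qed.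

(* Arguments of real functions such as [ln] are parsed in Stdlib's [R_scope];
   [%R] puts them back in MathComp's ring scope. *)
Lemma lnM (x y : R) : 0 < x -> 0 < y -> ln (x * y)%R = ln x + ln y.
Proof. by move=> /RltP x0 /RltP y0; exact: ln_mult. Qed.

Lemma lnX (x : R) k : 0 < x -> ln (x ^+ k) = k%:R * ln x.
Proof. by move=> /RltP x0; rewrite -powE ln_pow // INRE. Qed.

Lemma ln_prod (I : finType) (f : I -> R) : (forall i, 0 < f i) ->
  ln (\prod_i f i) = \sum_i ln (f i).
Proof.
(* Positivity of the partial products is carried along because [lnM] requires it. *)
move=> f0; suff [_] : 0 < \prod_i f i /\ ln (\prod_i f i) = \sum_i ln (f i) by [].
apply: (big_ind2 (fun x y => 0 < x /\ ln x = y)) => //.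
  by split=> //; exact: ln_1.
by move=> x1 y1 x2 y2 [x10 <-] [x20 <-]; rewrite mulr_gt0 ?lnM.
Qed.

Lemma ln_leif (x y : R) : 0 < x -> x <= y -> ln x <= ln y ?= iff (x == y).
Proof.
move=> x0 xy; apply/leifP; case: eqVneq => [->//|xNy].
by apply/RltP; apply: ln_increasing; apply/RltP; rewrite // lt_neqAle xNy.
Qed.

(** * The maximization problem in the coordinates [B] *)

Section Penalty.
Variables (N k : R) (q : nat).

Definition penalty (al b : R) : R :=
  (N * ln b - b ^+ q - k * al * b)%R.

(* With [b = t * l], the equation for [l] turns [N * ln t] into
   [l ^+ q * ln (t ^+ q) + k * al * l * ln t], and [ln s <= s - 1]. *)
Lemma penalty_le (al l b : R) : 0 <= k * al -> 0 < l -> 0 < b -> (0 < q)%N ->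
  q%:R * l ^+ q + k * al * l = N ->
  penalty al b <= penalty al l ?= iff (b == l).
Proof.
move=> ka0 l0 b0 q0 eqN; apply/leifP; case: eqVneq => [->//|bl].
pose t : R := b / l; have t0 : 0 < t by rewrite divr_gt0.
have tE : b = t * l by rewrite divfK ?gt_eqF.
clearbody t.
have t1 : t != 1 by apply: contraNneq bl => tt; rewrite tE tt mul1r.
(* [k * al] may be zero, so strictness has to come from the [q]-th power term. *)
have tq : t ^+ q != 1 by rewrite pexpr_eq1 // ltW.
have h1 : ln (t ^+ q) < t ^+ q - 1.
  by rewrite (lt_leif (ln_le_sub1 _)) // exprn_gt0.
have h2 : ln t <= t - 1 := (ln_le_sub1 t0).1.
have lq : 0 < l ^+ q by rewrite exprn_gt0.
have h3 : l ^+ q * ln (t ^+ q) < l ^+ q * (t ^+ q - 1) by rewrite ltr_pM2l.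
have h4 : k * al * l * ln t <= k * al * l * (t - 1).
  by rewrite ler_wpM2l // mulr_ge0 // ltW.
rewrite lnX // in h3.
rewrite -subr_gt0 in h3; rewrite -subr_ge0 in h4.
rewrite /penalty tE lnM // exprMn -eqN -subr_gt0.
have := ltr_wpDr h4 h3; congr (_ < _); ring.
Qed.

(** The [B]-dependent part of twice the log posterior at [mu = xbar X], where [k] is the sample size
    and [al] lists the eigenvalues [a]. *)
Definition objective p (al : 'I_p -> R) (B : 'M[R]_p) : R :=
  (N * ln (\det B) - \tr (B ^+ q) - k * \sum_i al i * B i i)%R.

Lemma objective_le p (al l : 'I_p -> R) (B : 'M[R]_p) :
  0 < N -> (0 < q)%N -> (forall i, 0 <= k * al i) -> (forall i, 0 < l i) ->
  (forall i, q%:R * l i ^+ q + k * al i * l i = N) -> pdmx B ->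
  objective al B <= objective al (diag_mx (\row_i l i))
    ?= iff (B == diag_mx (\row_i l i)).
Proof.
move=> N0 q0 ka0 l0 eqN pB; apply/leifP; case: eqVneq => [->//|Bl].
have Bii i := pdmx_diag_gt0 i pB.
have [dB HB] := pdmx_Hadamard pB.
have HP := leif_sum (fun i (_ : true) => penalty_le (ka0 i) (l0 i) (Bii i) q0 (eqN i)).
have pE (f : 'I_p -> R) : \sum_i penalty (al i) (f i) =
    N * \sum_i ln (f i) - \sum_i f i ^+ q - k * \sum_i al i * f i.
  rewrite !mulr_sumr -!sumrB; apply: eq_bigr => i _; rewrite /penalty.
  by rewrite mulrA.
have -> : objective al (diag_mx (\row_i l i)) = \sum_i penalty (al i) (l i).
  have dX j : (diag_mx (\row_i l i)) ^+ j = diag_mx (\row_i l i ^+ j).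
    elim: j => [|j IH].
      rewrite expr0 -[1]/(1%:M : 'M_p) -diag_const_mx; congr diag_mx.
      by apply/rowP => i; rewrite !mxE.
    rewrite exprS IH -mulmxE mulmx_diag; congr diag_mx.
    by apply/rowP => i; rewrite !mxE exprS.
  rewrite pE /objective dX mxtrace_diag det_diag.
  have -> : \prod_i (\row_i l i) 0 i = \prod_i l i.
    by apply: eq_bigr => i _; rewrite mxE.
  rewrite ln_prod //; congr (_ - _ - k * _); apply: eq_bigr => i _; rewrite !mxE //.
  by rewrite eqxx.
have HX : \sum_i B i i ^+ q <= \tr (B ^+ q).
  by apply: ler_sum => i _; exact: pdmx_exp_diag.
have HD := ln_leif dB HB.1; rewrite HB.2 ln_prod // in HD.
have le1 : objective al B <= \sum_i penalty (al i) (B i i).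
  by rewrite pE /objective !lerB // ler_pM2l // HD.1.
(* If [B] is not diagonal, Hadamard's inequality is strict; if it is, some diagonal entry differs
   from [l i] and the sum of penalties is strictly smaller. *)
have [dgB|ndB] := boolP (is_diag_mx B); last first.
  apply: lt_le_trans HP.1; rewrite pE /objective ltrD2r ltr_leD ?lerN2 //.
  by rewrite ltr_pM2l // (lt_leif HD).
apply: le_lt_trans le1 _; rewrite (lt_leif HP); apply: contra Bl => /forallP Bl.
apply/eqP/matrixP => i j; rewrite !mxE; case: eqVneq => [<-|ij].
  by rewrite mulr1n; apply/eqP/Bl.
by rewrite mulr0n (is_diag_mxP dgB).
Qed.

End Penalty.

(** * Sample mean and scatter matrix *)

Section Scatter.
Variables (p n : nat) (X : 'I_n -> 'cV[R]_p).
Hypothesis n_gt0 : (0 < n)%N.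

Let nN0 : n%:R != 0 :> R. Proof. by rewrite pnatr_eq0 -lt0n. Qed.

Lemma sum_sub_xbar : \sum_i (X i - xbar X) = 0.
Proof.
rewrite sumrB sumr_const card_ord /xbar INRE -scaler_nat scalerA.
by rewrite mulfV // scale1r subrr.
Qed.

Lemma scov_ge0 x : 0 <= bform (scov X) x x.
Proof.
rewrite /bform /scov INRE -scalemxAr -scalemxAl mxE mulr_ge0 //.
  by rewrite invr_ge0 ler0n.
rewrite mulmx_sumr mulmx_suml summxE sumr_ge0 // => i _.
set d := X i - xbar X.
have -> : x^T *m (d *m d^T) *m x = (x^T *m d) *m (x^T *m d)^T.
  by rewrite trmx_mul trmxK !mulmxA.
by rewrite mxE big_ord1 !mxE -expr2 sqr_ge0.
Qed.

(** Deviations from the mean sum to zero, so the cross terms vanish and [mu] is confined to a single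
    quadratic form. *)
Lemma scatter_decomposition (P : 'M[R]_p) mu : P^T = P ->
  \sum_i bform P (X i - mu) (X i - mu) =
  n%:R * \tr (P *m scov X) + n%:R * bform P (xbar X - mu) (xbar X - mu).
Proof.
move=> sP; set d := xbar X - mu.
have E i : bform P (X i - mu) (X i - mu) =
    \tr (P *m ((X i - xbar X) *m (X i - xbar X)^T)) +
    2 * bform P d (X i - xbar X) + bform P d d.
  have -> : X i - mu = (X i - xbar X) - (-1) *: d.
    by rewrite scaleN1r opprK subrKA.
  (* By cyclicity the trace becomes that of a 1 by 1 matrix, which is its only entry. *)
  rewrite bform_sub // mulmxA mxtrace_mulC mulmxA [\tr _]big_ord1.
  by rewrite -/(bform P _ _); ring.
rewrite (eq_bigr _ (fun i _ => E i)) !big_split /= sumr_const card_ord.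
rewrite -mulr_sumr.
have -> : \sum_i bform P d (X i - xbar X) = 0.
  by rewrite /bform -summxE -mulmx_sumr sum_sub_xbar mulmx0 mxE.
rewrite mulr0 addr0; congr (_ + _); last by rewrite mulr_natl.
rewrite -raddf_sum -mulmx_sumr /scov INRE -scalemxAr mxtraceZ mulrA mulfV //.
by rewrite mul1r.
Qed.

End Scatter.

(** * Matrix inverses and powers under congruence, and the scalar equation *)

Lemma invmx_mul (K : comUnitRingType) p (A B : 'M[K]_p) :
  A \in unitmx -> B \in unitmx -> invmx (A *m B) = invmx B *m invmx A.
Proof.
move=> uA uB; have uAB : A *m B \in unitmx by rewrite unitmx_mul uA.
by rewrite -[RHS](mulmxK uAB) mulmxA mulmxKV // mulVmx // mul1mx.
Qed.

(** Yields both cancellation laws between [coord] and [uncoord]. *)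
Lemma invmx_congrK (K : comUnitRingType) p (T S : 'M[K]_p) :
  T \in unitmx -> S \in unitmx ->
  T *m invmx (T^T *m invmx S *m T) *m T^T = S.
Proof.
move=> uT uS; have uTt : T^T \in unitmx by rewrite unitmx_tr.
rewrite !invmx_mul ?unitmx_mul ?uTt ?unitmx_inv // invmxK !mulmxA mulmxV //.
by rewrite mul1mx mulmxKV.
Qed.

Lemma mulmxV_exp p (V W : 'M[R]_p) k : V *m V^T = 1%:M ->
  (V^T *m W *m V) ^+ k = V^T *m W ^+ k *m V.
Proof.
move=> VV; elim: k => [|k IH].
  by rewrite !expr0 -[1]/(1%:M : 'M_p) mulmx1 (mulmx1C VV).
by rewrite !exprS IH -!mulmxE !mulmxA -(mulmxA _ V) VV mulmx1.
Qed.

(** Existence is the intermediate value theorem on the interval from 0 to [N + 1]; uniqueness is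
    strict monotonicity on the nonnegative reals. *)
Lemma exists_unique_root (q : nat) (k N : R) : (0 < q)%N -> 0 <= k -> 0 < N ->
  exists! x : R, 0 < x /\ q%:R * x ^+ q + k * x = N.
Proof.
move=> q0 k0 N0; pose f (x : R) : R := (q%:R * pow x q + k * x - N)%R.
have f_incr x y : 0 <= x -> x < y -> f x < f y.
  move=> x0 xy; rewrite /f !powE ltrD2r ltr_leD //.
    by rewrite ltr_pM2l ?ltr0n // ltrXn2r // -lt0n.
  by rewrite ler_wpM2l // ltW.
have f_cont : continuity f.
  change (continuity (fun x => Rminus (Rplus (Rmult q%:R (pow x q)) (Rmult k x)) N)).
  by reg.
have f0 : f 0 < 0 by rewrite /f powE expr0n eqn0Ngt q0 !mulr0 !add0r oppr_lt0.
have N10 : 0 < N + 1 by rewrite addr_gt0.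
(* Since [N + 1] is at least 1, its [q]-th power is at least [N + 1], hence above [N]. *)
have fN : 0 < f (N + 1).
  have N1 : 1 <= N + 1 by rewrite lerDr ltW.
  have le1 : N + 1 <= q%:R * (N + 1) ^+ q.
    apply: le_trans (ler_peMl _ _); rewrite ?ler1n ?exprn_ge0 ?(ltW N10) //.
    exact: ler_eXnr.
  rewrite /f powE subr_gt0; apply: lt_le_trans (_ : N < N + 1) _.
    by rewrite ltrDl.
  by apply: le_trans le1 _; rewrite lerDl mulr_ge0 // ltW.
have [z [[/RleP z0 _] fz]] := IVT _ _ _ f_cont (elimT (RltP _ _) N10)
  (elimT (RltP _ _) f0) (elimT (RltP _ _) fN).
have fE x : f x = 0 <-> q%:R * x ^+ q + k * x = N.
  by rewrite /f powE; split=> [/eqP|->]; rewrite ?subrr // subr_eq0 => /eqP.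
exists z; split=> [|y [y0 /fE fy]].
  split; last exact/fE.
  (* [IVT] gives only [0 <= z]; [f 0 < 0] rules out zero. *)
  by rewrite lt_neqAle z0 andbT; apply: contraTneq f0 => e; rewrite {1}e fz ltxx.
case: (ltrgtP z y) => // zy; [have := f_incr _ _ z0 zy|have := f_incr _ _ (ltW y0) zy].
  by rewrite fz fy ltxx.
by rewrite fz fy ltxx.
Qed.

(** * Change of variables from [Sig] to [B] *)

Section Reduction.
Variables (p n q : nat) (X : 'I_n -> 'cV[R]_p) (Psi Psih V : 'M[R]_p).
Variables (a : 'I_p -> R) (m c N : R).
Hypotheses (n_gt0 : (0 < n)%N) (pPsih : pdmx Psih) (sqrtPsi : Psih *m Psih = Psi).
Hypothesis hV : V^T *m V = 1%:M.
Hypothesis hA : invmx Psih *m scov X *m invmx Psih = V *m diag_mx (\row_i a i) *m V^T.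
Hypothesis defN : N = n%:R + p%:R + q%:R * m + 1.

Let uP : Psih \in unitmx. Proof. exact: pdmx_unit. Qed.
Let hV' : V *m V^T = 1%:M. Proof. exact: mulmx1C. Qed.
Let uV : V \in unitmx. Proof. by case/mulmx1_unit: hV'. Qed.
Let uPV : Psih *m V \in unitmx. Proof. by rewrite unitmx_mul uP. Qed.
Let trPV : (Psih *m V)^T = V^T *m Psih. Proof. by rewrite trmx_mul pPsih.1. Qed.

(** [a i] is the value of the form of [scov X] at column [i] of [invmx Psih *m V]. *)
Lemma scov_coord_ge0 i : 0 <= a i.
Proof.
have -> : a i = (V^T *m (invmx Psih *m scov X *m invmx Psih) *m V) i i.
  by rewrite hA !mulmxA hV mul1mx -mulmxA hV mulmx1 !mxE eqxx mulr1n.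
have -> : V^T *m (invmx Psih *m scov X *m invmx Psih) *m V =
    (invmx Psih *m V)^T *m scov X *m (invmx Psih *m V).
  by rewrite trmx_mul trmx_inv pPsih.1 !mulmxA.
by rewrite -bform_delta bform_congr scov_ge0.
Qed.

Definition coord (Sig : 'M[R]_p) : 'M[R]_p :=
  (Psih *m V)^T *m invmx Sig *m (Psih *m V).

(** A congruence by the transpose of [Psih *m V], so that [pdmx_congr] and [invmx_congrK] apply. *)
Definition uncoord (B : 'M[R]_p) : 'M[R]_p :=
  (V^T *m Psih)^T *m invmx B *m (V^T *m Psih).

Lemma coordK Sig : pdmx Sig -> uncoord (coord Sig) = Sig.
Proof.
move=> /pdmx_unit uS; rewrite /uncoord /coord -trPV.
by rewrite trmxK invmx_congrK.
Qed.

Lemma uncoordK B : pdmx B -> coord (uncoord B) = B.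
Proof.
move=> /pdmx_unit uB; rewrite /uncoord /coord -trPV.
by rewrite -[X in _ *m X]trmxK invmx_congrK // unitmx_tr.
Qed.

Lemma pdmx_coord Sig : pdmx Sig -> pdmx (coord Sig).
Proof. by move=> /pdmx_inv; apply: pdmx_congr. Qed.

Lemma pdmx_uncoord B : pdmx B -> pdmx (uncoord B).
Proof. by move=> /pdmx_inv; apply: pdmx_congr; rewrite -trPV unitmx_tr. Qed.

(** The likelihood and the prior together carry [\det Sig] to the power [- N / 2]. As [\det Sig] is
    [\det Psi] over [\det (coord Sig)], this becomes a constant times a power of
    [\det (coord Sig)]. *)
Lemma posteriorE mu Sig : pdmx Sig ->
  posterior X c Psi Psih m q mu Sig =
  Rinv c * Rpower (\det Psi) (q%:R * m / 2)%R * exp (- (N / 2) * ln (\det Psi))%R *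
  exp (2^-1 * (objective N n%:R q a (coord Sig)
               - n%:R * bform (invmx Sig) (xbar X - mu) (xbar X - mu)))%R.
Proof.
move=> pS; have uS := pdmx_unit pS; have pSi := pdmx_inv pS.
have [dS _] := pdmx_Hadamard pS; have pB := pdmx_coord pS.
have [dB _] := pdmx_Hadamard pB.
(* The prior's matrix [invmx W] is orthogonally conjugate to [coord Sig], so their powers have equal
   traces. *)
have trW : \tr (invmx (invmx Psih *m Sig *m invmx Psih) ^+ q) = \tr (coord Sig ^+ q).
  have -> : invmx (invmx Psih *m Sig *m invmx Psih) = Psih *m invmx Sig *m Psih.
    by rewrite !invmx_mul ?unitmx_mul ?unitmx_inv ?uP ?uS // invmxK mulmxA.
  have -> : coord Sig = V^T *m (Psih *m invmx Sig *m Psih) *m V.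
    by rewrite /coord trPV !mulmxA.
  by rewrite mulmxV_exp // mxtrace_mulC mulmxA hV' mul1mx.
have trS : \tr (invmx Sig *m scov X) = \sum_i a i * coord Sig i i.
  have -> : scov X = Psih *m V *m diag_mx (\row_i a i) *m (Psih *m V)^T.
    rewrite trPV mulmxA -(mulmxA Psih) -(mulmxA Psih) -hA !mulmxA.
    by rewrite mulmxV // mul1mx mulmxKV.
  set D := diag_mx _; set T := Psih *m V.
  have -> : \tr (invmx Sig *m (T *m D *m T^T)) = \tr (coord Sig *m D).
    by rewrite mulmxA mxtrace_mulC /coord !mulmxA.
  rewrite mul_mx_diag.
  by apply: eq_bigr => i _; rewrite mxE [(\row__ _) _ _]mxE mulrC.
have detB : ln (\det Psi) = ln (\det (coord Sig)) + ln (\det Sig).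
  rewrite -lnM //; congr ln; rewrite -sqrtPsi /coord !det_mulmx det_tr.
  rewrite det_inv det_mulmx.
  have VV : \det V * \det V = 1.
    by have := congr1 determinant hV; rewrite det_mulmx det_tr det1.
  transitivity (\det Psih * \det Psih * (\det V * \det V)).
    by rewrite VV mulr1.
  by field; rewrite gt_eqF.
rewrite /posterior /lik /piw_density /Rpower.
rewrite trW scatter_decomposition ?pSi.1 // trS !INRE.
have expD x y : exp (x + y)%R = exp x * exp y by exact: exp_plus.
(* With [Rpower] unfolded, all factors depending on [mu] or [Sig] are exponentials, so it suffices
   to compare the sums of exponents. *)
have regroup (x y z w k t u v : R) : x + y + z + w = u + v ->
    exp x * exp y * (k * exp z * t * exp w) = k * t * exp u * exp v.
  move=> e; have e' : exp x * exp y * exp z * exp w = exp u * exp v.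
    by rewrite -!expD e.
  by rewrite -[RHS]mulrA -e'; ring.
apply: regroup; rewrite detB defN /objective.
move: (ln (\det (coord Sig))) (ln (\det Sig)) (\tr _) (bform _ _ _) (\sum_i _).
have E (ms lb ls t f s n' p' q' : R) :
    - (n' / 2) * ls + - 2^-1 * (n' * s + n' * f) + - 2^-1 * t +
    - ((q' * ms + p' + 1) / 2) * ls =
  - ((n' + p' + q' * ms + 1) / 2) * (lb + ls) +
  2^-1 * ((n' + p' + q' * ms + 1) * lb - t - n' * s - n' * f).
  by field.
by move=> lb ls t f s; exact: E.
Qed.

End Reduction.

Theorem theorem3
  (p n : nat) (hn : (1 <= n)%N) (X : 'I_n -> 'cV[R]_p)
  (Psi Psih : 'M[R]_p) (hPsi : posdef Psi)
  (hPsih : posdef Psih) (hsqrt : Psih *m Psih = Psi)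
  (m : R) (hm : Rle (INR p) m) (q : nat) (hq : (1 <= q)%N)
  (c : R) (hc : Rlt (IZR Z0) c)
  (V : 'M[R]_p) (a : 'I_p -> R)
  (hV : V^T *m V = 1%:M)
  (hA : invmx Psih *m scov X *m invmx Psih = V *m diag_mx (\row_i a i) *m V^T) :
  let N : R := Rplus (Rplus (Rplus (INR n) (INR p)) (Rmult (INR q) m)) (IZR (Zpos xH)) in
  (* (i) *)
  (forall i : 'I_p, exists! lam : R, Rlt (IZR Z0) lam /\
      Rminus (Rplus (Rmult (INR q) (pow lam q)) (Rmult (Rmult (INR n) (a i)) lam)) N
      = IZR Z0) /\
  (* (ii) *)
  (forall lamh : 'I_p -> R,
     (forall i, Rlt (IZR Z0) (lamh i) /\
        Rminus (Rplus (Rmult (INR q) (pow (lamh i) q)) (Rmult (Rmult (INR n) (a i)) (lamh i))) N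
        = IZR Z0) ->
     let Sigh := Psih *m V *m invmx (diag_mx (\row_i lamh i)) *m V^T *m Psih in
     posdef Sigh /\
     forall (mu : 'cV[R]_p) (Sig : 'M[R]_p), posdef Sig ->
       (mu, Sig) <> (xbar X, Sigh) ->
       Rlt (posterior X c Psi Psih m q mu Sig) (posterior X c Psi Psih m q (xbar X) Sigh)).
Proof.
move=> N.
have NE : N = n%:R + p%:R + q%:R * m + 1 by rewrite /N !INRE.
have N0 : 0 < N.
  have m0 : 0 <= m by apply: le_trans (ler0n _ p) _; rewrite -INRE; apply/RleP.
  by rewrite NE ltr_wpDl // !addr_ge0 ?mulr_ge0 ?ler0n.
have /posdefP pPsih := hPsih.
have a0 i : 0 <= n%:R * a i.
  by rewrite mulr_ge0 ?ler0n // (scov_coord_ge0 pPsih hV hA).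
have rootE i (x : R) : (Rlt (IZR Z0) x /\
    Rminus (Rplus (Rmult (INR q) (pow x q)) (Rmult (Rmult (INR n) (a i)) x)) N
      = IZR Z0) <-> (0 < x /\ q%:R * x ^+ q + n%:R * a i * x = N).
  rewrite !INRE powE -[Rminus _ _]/(q%:R * x ^+ q + n%:R * a i * x - N).
  split=> -[/RltP x0 e]; split=> //; last by rewrite e subrr.
  by apply/eqP; rewrite -subr_eq0; apply/eqP.
split=> [i|l hl Sigh].
  have [x [hx ux]] := exists_unique_root hq (a0 i) N0.
  by exists x; split=> [|y /rootE]; [apply/rootE | apply: ux].
have l0 i : 0 < l i by have /rootE[] := hl i.
have lE i : q%:R * l i ^+ q + n%:R * a i * l i = N by have /rootE[] := hl i.
set D := diag_mx (\row_i l i) in Sigh *.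
have pD : pdmx D by apply: pdmx_diag => i; rewrite mxE.
(* The candidate is the matrix whose coordinates are the diagonal matrix of roots. *)
have SE : Sigh = uncoord Psih V D.
  by rewrite /Sigh /uncoord trmx_mul trmxK pPsih.1 !mulmxA.
have pSh : pdmx Sigh by rewrite SE; exact: pdmx_uncoord.
split=> [|mu Sig /posdefP pS neq]; first exact/posdefP.
apply/RltP; rewrite !(posteriorE c hn pPsih hsqrt hV hA NE) //.
(* The common factor is positive, so only the last exponents need comparing; at [xbar X] the form in
   [mu] vanishes. *)
have K0 : 0 < Rinv c * Rpower (\det Psi) (q%:R * m / 2)%R *
    exp (- (N / 2) * ln (\det Psi))%R.
  by rewrite !mulr_gt0 //; apply/RltP; try exact: exp_pos; exact: Rinv_0_lt_compat.
rewrite ltr_pM2l //; apply/RltP/exp_increasing/RltP.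
rewrite ltr_pM2l ?invr_gt0 ?ltr0n // subrr [bform _ 0 0]/bform mulmx0 mxE mulr0 subr0.
rewrite SE uncoordK //.
have n0 : 0 < n%:R :> R by rewrite ltr0n.
have leO := objective_le N0 hq a0 l0 lE (pdmx_coord pPsih hV pS).
have qf0 := pdmx_ge0 (xbar X - mu) (pdmx_inv pS).
(* If [Sig] differs from [Sigh], injectivity of [coord] makes the objective strictly smaller;
   otherwise [mu] differs from the mean and its form is positive. *)
have [SS|SN] := eqVneq Sig Sigh; last first.
  apply: le_lt_trans (_ : objective N n%:R q a (coord Psih V Sig) < _).
    by rewrite gerBl mulr_ge0 // ltW.
  rewrite (lt_leif leO); apply: contra SN => /eqP cS.
  by rewrite -(coordK pPsih hV pS) cS SE.
apply: lt_le_trans leO.1; rewrite ltrBlDr ltrDl pmulr_rgt0 //.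
apply: (pdmx_inv pS).2; rewrite subr_eq0; apply/eqP => e.
by apply: neq; rewrite SS e.
Qed.
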